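(* Let $\mu>0$, $s>0$, $\beta\in[0,1]$, and let $f\in\mathcal S^2_\mu(\mathbb R^n):=\bigcup_{L\ge\mu}\mathcal S^2_{\mu,L}(\mathbb R^n)$. Then the $\beta$-High Resolution ODE $$\ddot X(t)+2\sqrt\mu\,\dot X(t)+\beta\sqrt s\,\nabla^2 f(X(t))\dot X(t)+(1+\sqrt{\mu s})\nabla f(X(t))=0,$$ with initial conditions $X(0)=x_0$ and $\dot X(0)=-\frac{2\sqrt s\,\nabla f(x_0)}{1+\sqrt{\mu s}}$ (for arbitrary $x_0\in\mathbb R^n$), has a unique global solution $X\in C^2([0,\infty);\mathbb R^n)$.
   Context: $\mathcal F^1_L(\mathbb R^n)$: differentiable convex $f:\mathbb R^n\to\mathbb R$ with $\|\nabla f(x)-\nabla f(y)\|\le L\|x-y\|$. $\mathcal F^2_L(\mathbb R^n)$: the subclass of $\mathcal F^1_L(\mathbb R^n)$ of twice differentiable $f$ whose Hessian is Lipschitz in Frobenius norm, $\|\nabla^2 f(x)-\nabla^2 f(y)\|_F\le L'\|x-y\|$ for some constant $L'>0$. $\mathcal S^2_{\mu,L}(\mathbb R^n)$: the subclass of $\mathcal F^2_L(\mathbb R^n)$ of $\mu$-strongly convex functions, $f(y)\ge f(x)+\langle\nabla f(x),y-x\rangle+\frac\mu2\|y-x\|^2$, with $0<\mu\le L$. *)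

(* Defs.v *)
From HB Require Import structures.
From mathcomp Require Import all_boot all_order all_algebra.
From mathcomp Require Import all_classical all_reals all_analysis.
Set Implicit Arguments. Unset Strict Implicit. Unset Printing Implicit Defensive.
Import Order.TTheory GRing.Theory Num.Theory.
Import numFieldNormedType.Exports.
Local Open Scope classical_set_scope.
Local Open Scope ring_scope.

Section Defs.
Variables (R : realType) (n : nat).
Implicit Types (x y u v : 'rV[R]_n) (f : 'rV[R]_n -> R).

(* Euclidean inner product and norm (the library's norm on 'rV is the max norm). *)
Definition dotp u v : R := \sum_(i < n) u ord0 i * v ord0 i.
Definition enorm v : R := Num.sqrt (dotp v v).
Definition frob (M : 'M[R]_n) : R := Num.sqrt (\sum_(i < n) \sum_(j < n) M i j ^+ 2).

Definition ebase (i : 'I_n) : 'rV[R]_n := delta_mx ord0 i.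

Definition grad f x : 'rV[R]_n := \row_i ('D_(ebase i) f x).
Definition hess f x : 'M[R]_n := \matrix_(i, j) ('D_(ebase j) (fun y => grad f y ord0 i) x).
Definition hessmul f x v : 'rV[R]_n := \row_i \sum_(j < n) hess f x i j * v ord0 j.

Definition convex_fun f :=
  forall x y (t : R), 0 <= t <= 1 -> f (t *: x + (1 - t) *: y) <= t * f x + (1 - t) * f y.

Definition F1 (L : R) f :=
  (forall x, differentiable f x) /\ convex_fun f /\
  (forall x y, enorm (grad f x - grad f y) <= L * enorm (x - y)).

Definition F2 (L : R) f :=
  F1 L f /\ (forall x, differentiable (grad f) x) /\
  (exists L' : R, 0 < L' /\ forall x y, frob (hess f x - hess f y) <= L' * enorm (x - y)).

Definition strongly_convex (mu : R) f :=
  forall x y, f y >= f x + dotp (grad f x) (y - x) + mu / 2 * enorm (y - x) ^+ 2.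

Definition S2 (mu L : R) f := F2 L f /\ strongly_convex mu f /\ 0 < mu <= L.
Definition S2mu (mu : R) f := exists L : R, mu <= L /\ S2 mu L f.

(* V is the derivative of X at every t in [0, oo) (one-sided at t = 0). *)
Definition deriv_nonneg (X V : R -> 'rV[R]_n) :=
  forall t : R, 0 <= t ->
    (fun h : R => h^-1 *: (X (t + h) - X t)) @ within (fun h : R => 0 <= t + h) ((0:R)^')
      --> V t.

Definition C2_nonneg (X X1 X2 : R -> 'rV[R]_n) :=
  deriv_nonneg X X1 /\ deriv_nonneg X1 X2 /\
  {within [set t : R | 0 <= t], continuous X2}.

Definition HR_solution (mu s beta : R) f (x0 : 'rV[R]_n) (X : R -> 'rV[R]_n) :=
  exists X1 X2 : R -> 'rV[R]_n,
    C2_nonneg X X1 X2 /\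
    X 0 = x0 /\
    X1 0 = - ((2 * Num.sqrt s) / (1 + Num.sqrt (mu * s))) *: grad f x0 /\
    forall t : R, 0 <= t ->
      X2 t + (2 * Num.sqrt mu) *: X1 t
      + (beta * Num.sqrt s) *: hessmul f (X t) (X1 t)
      + (1 + Num.sqrt (mu * s)) *: grad f (X t) = 0.

End Defs.

(* Main.v *)
Require Import Defs.
From HB Require Import structures.
From mathcomp Require Import all_boot all_order all_algebra.
From mathcomp Require Import all_classical all_reals all_analysis.
From mathcomp Require Import ring lra.
Import Order.TTheory GRing.Theory Num.Theory.
Import numFieldNormedType.Exports.
Local Open Scope classical_set_scope.
Local Open Scope ring_scope.

(** Write a = 2 sqrt(mu), b = beta sqrt(s), c = 1 + sqrt(mu s). Since
    hess f(X) X' is the derivative of grad f(X), the new variable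
    V = X' + a X + b grad f(X) turns the equation into the first-order system
      X' = V - a X - b grad f(X),   V' = - c grad f(X),
    which no longer contains the Hessian and is globally Lipschitz because
    grad f is. Picard iteration is then a contraction of ratio 1/2 for the
    weighted sup norm sup_t exp(-2 K t) |X(t)|, K being the Lipschitz constant;
    this gives global existence and uniqueness at once. Differentiability of
    grad f makes the solution C^1 in (X, V), hence C^2 in X, and continuity of
    the Hessian makes X'' continuous. *)

(** * Globally Lipschitz systems *)

(** The mean value theorem applies to [h - g] and [h + g], both of which have nonnegative
    derivative. No integrability of [dg] is involved. *)
Lemma normr_increment_le (R : realType) (g h dg dh : R -> R) (a b : R) :
  a <= b ->
  {within `[a, b], continuous g} -> {within `[a, b], continuous h} ->
  (forall t : R, a < t < b -> is_derive t 1 g (dg t)) ->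
  (forall t : R, a < t < b -> is_derive t 1 h (dh t)) ->
  (forall t : R, a < t < b -> `|dg t| <= dh t) ->
  `|g b - g a| <= h b - h a.
Proof.
rewrite le_eqVlt => /predU1P[<- _ _ _ _ _|ab cg ch Dg Dh dgh].
  by rewrite !subrr normr0.
have [||c] := @MVT R (h - g) (dh - dg) a b ab.
- by move=> t; rewrite in_itv/= => tab; apply: is_deriveB; [exact: Dh|exact: Dg].
- by move=> t; apply: continuousD; [exact: ch|apply: continuousN; exact: cg].
rewrite in_itv/= => cab.
rewrite -[LHS]/(h b - g b - (h a - g a)) -[RHS]/((dh c - dg c) * (b - a)) => Ec.
have [||d] := @MVT R (h + g) (dh + dg) a b ab.
- by move=> t; rewrite in_itv/= => tab; apply: is_deriveD; [exact: Dh|exact: Dg].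
- by move=> t; apply: continuousD; [exact: ch|exact: cg].
rewrite in_itv/= => dab.
rewrite -[LHS]/(h b + g b - (h a + g a)) -[RHS]/((dh d + dg d) * (b - a)) => Ed.
have := dgh c cab; have := dgh d dab; rewrite !ler_norml => /andP[d1 d2] /andP[c1 c2].
have P1 : 0 <= (dh c - dg c) * (b - a) by apply: mulr_ge0; lra.
have P2 : 0 <= (dh d + dg d) * (b - a) by apply: mulr_ge0; lra.
by rewrite -Ec in P1; rewrite -Ed in P2; lra.
Qed.

Lemma antiderivative (R : realType) (u : R -> R) : continuous u ->
  exists U : R -> R, U 0 = 0 /\ forall t : R, 0 <= t -> is_derive t 1 U (u t).
Proof.
move=> cu.
(* Integrating from -1 makes 0 an interior point, so the derivative at [t = 0] is two-sided;
   subtracting [V 0] restores the normalization. *)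
pose V (x : R) := (\int[@lebesgue_measure R]_(t in [set` `[(-1)%R, x]]) u t)%R.
exists (fun x => V x - V 0); split; first by rewrite subrr.
move=> t t0.
have [|||| dV V't] := @continuous_FTC1_closed R u (-1) t (t + 1).
- by rewrite ltrDl.
- apply: continuous_compact_integrable; first exact: segment_compact.
  exact: continuous_subspaceT.
- by rewrite (lt_le_trans _ t0)// ltrN10.
- exact: cu.
have DV : is_derive t 1 V (u t).
  exact: (DeriveDef dV (etrans (esym (derive1E V t)) V't)).
have -> : (fun x => V x - V 0) = V - cst (V 0) by apply/funext.
by apply: is_derive_eq; rewrite subr0.
Qed.

(** Source of the ratio 1/2: integrating [K * C * expR (2 * K * t)] divides by the rate [2 * K],
    leaving [C / 2] in front of the exponential. *)
Lemma halve_exp_bound (R : realType) (K C T : R) (g dg : R -> R) :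
  0 < K -> 0 <= T -> {within `[0, T], continuous g} ->
  (forall t : R, 0 < t < T -> is_derive t 1 g (dg t)) ->
  (forall t : R, 0 < t < T -> `|dg t| <= K * (C * expR (2 * K * t))) ->
  g 0 = 0 -> 0 <= C -> `|g T| <= C / 2 * expR (2 * K * T).
Proof.
move=> K0 T0 cg Dg dgK g0 C0.
pose h t := C / 2 * expR (2 * K * t).
have Dh (t : R) : is_derive t 1 h (K * (C * expR (2 * K * t))).
  rewrite /h {h}.
  have D1 : is_derive t 1 (fun t : R => expR (2 * K * t)) (2 * K * expR (2 * K * t)).
    have De : is_derive (2 * K * t) (1:R) (@expR R) (expR (2 * K * t)).
      exact: is_derive_expR.
    have Dl : is_derive t 1 (fun t : R => 2 * K * t) (2 * K).
      have -> : (fun t : R => 2 * K * t) = (2 * K) \*: (@id R) by [].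
      by apply: is_derive_eq; rewrite /GRing.scale/= mulr1.
    have De' := @is_derive1_comp _ expR (fun t : R => 2 * K * t) _ _ _ De Dl.
    by apply: (is_derive_eq De'); rewrite mulrC.
  have -> : (fun t : R => C / 2 * expR (2 * K * t)) =
      (C / 2) \*: (fun t : R => expR (2 * K * t)) by [].
  by apply: is_derive_eq; rewrite /GRing.scale/=; field.
have ch : {within `[0, T], continuous h}.
  by apply: derivable_within_continuous => t _; have := Dh t; case.
have := @normr_increment_le _ g h dg _ 0 T T0 cg ch Dg (fun t _ => Dh t) dgK.
rewrite g0 subr0 /h => /le_trans; apply.
by rewrite lerBlDr lerDl mulr_ge0// ?divr_ge0 ?expR_ge0.
Qed.

Lemma le0_of_le_halves (R : realType) (a c : R) :
  (forall k, a <= c / 2 ^+ k) -> a <= 0.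
Proof.
move=> ac.
have half1 : `|2^-1 : R| < 1 by rewrite ger0_norm ?invr_ge0// invf_lt1// ltr1n.
have /(cvgr_to_ge (b := a)) := cvg_geometric c half1; apply.
by apply: nearW => k; rewrite /geometric/= exprVn.
Qed.

(** Lipschitz for the sup norm; the coordinatewise form avoids putting a norm
    on [I -> R]. *)
Definition coord_lipschitz {R : realType} {I : Type} (K : R)
    (F : (I -> R) -> I -> R) :=
  forall x y e, (forall i, `|x i - y i| <= e) ->
    forall i, `|F x i - F y i| <= K * e.

Lemma common_bound (R : realType) (I : finType) (P : I -> R -> Prop) :
  (forall i a b, a <= b -> P i a -> P i b) ->
  (forall i, exists a, P i a) -> exists2 c, 0 <= c & forall i, P i c.
Proof.
move=> Ple Pex.
have [a Pa] := choice Pex.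
exists (\sum_i `|a i|); first exact: sumr_ge0.
move=> i; apply: (Ple i (a i)) => //.
by rewrite (bigD1 i)//= (le_trans (ler_norm _))// lerDl sumr_ge0.
Qed.

(** The difference is bounded on the compact interval, and each use of [halve_exp_bound] halves that
    bound, so it vanishes. Derivatives are asked only for [0 < t < T], since a one-sided solution
    need not have a two-sided derivative at 0. *)
Lemma lipschitz_ode_unique (R : realType) (I : finType)
    (F : (I -> R) -> I -> R) (K T : R) (x y : R -> I -> R) :
  0 < K -> coord_lipschitz K F -> 0 <= T ->
  (forall i, {within `[0, T], continuous (fun t => x t i)}) ->
  (forall i, {within `[0, T], continuous (fun t => y t i)}) ->
  (forall i (t : R), 0 < t < T -> is_derive t 1 (fun t => x t i) (F (x t) i)) ->
  (forall i (t : R), 0 < t < T -> is_derive t 1 (fun t => y t i) (F (y t) i)) ->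
  x 0 =1 y 0 -> x T =1 y T.
Proof.
move=> K0 FK T0 cx cy Dx Dy xy0.
have cxy i : {within `[0, T], continuous (fun t => x t i - y t i)}.
  by move=> t; apply: cvgB; [exact: cx|exact: cy].
have [C C0 xyC] : exists2 C : R, 0 <= C &
    forall i (t : R), 0 <= t <= T -> `|x t i - y t i| <= C.
  apply: (@common_bound R I (fun i C =>
      forall t, 0 <= t <= T -> `|x t i - y t i| <= C)).
    by move=> i a b ab xya t /xya /le_trans; apply.
  move=> i.
  have [|c _ cmax] := @EVT_max R (fun t => `|x t i - y t i|) 0 T T0.
    by move=> t; apply: cvg_norm; exact: cxy.
  by exists (`|x c i - y c i|) => t tT; apply: cmax; rewrite in_itv.
have bnd k : forall (t : R) i, 0 <= t <= T ->
    `|x t i - y t i| <= C / 2 ^+ k * expR (2 * K * t).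
  elim: k => [t i tT|k IH t i /andP[t0 tT]].
    rewrite expr0 divr1 (le_trans (xyC i t tT))// ler_peMr//.
    by rewrite -expR0 ler_expR !mulr_ge0// ?(ltW K0)//; case/andP: tT.
  rewrite exprSr invfM mulrA.
  apply: (@halve_exp_bound R K _ t (fun t => x t i - y t i)
    (fun t => F (x t) i - F (y t) i)) => //.
  - apply: continuous_subspaceW (cxy i) => u /=; rewrite !in_itv/= => /andP[-> ut].
    exact: le_trans ut tT.
  - move=> u /andP[u0 ut]; have uT : 0 < u < T by rewrite u0 (lt_le_trans ut).
    by apply: is_deriveB; [exact: Dx|exact: Dy].
  - move=> u /andP[u0 ut]; apply: FK => j; apply: IH.
    by rewrite (ltW u0) (le_trans (ltW ut)).
  - by rewrite xy0 subrr.
  - by rewrite divr_ge0// exprn_ge0.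
move=> i; apply/eqP; rewrite -subr_eq0 -normr_le0.
apply: (@le0_of_le_halves _ _ (C * expR (2 * K * T))) => k.
by rewrite mulrAC; apply: bnd; rewrite T0 lexx.
Qed.

Lemma continuous_coord_lipschitz (R : realType) (I : finType) (K : R)
    (F : (I -> R) -> I -> R) (x : R -> I -> R) (t : R) :
  0 < K -> coord_lipschitz K F ->
  (forall i, {for t, continuous (fun t => x t i)}) ->
  forall i, {for t, continuous (fun t => F (x t) i)}.
Proof.
move=> K0 FK cx i; apply/cvgrPdist_le => e e0; near=> u.
rewrite -[e](divfK (lt0r_neq0 K0)) mulrC; apply: FK.
near: u; apply: filter_forall => j.
by apply: (cvgrPdist_le _ _).1 (cx j) _ _; rewrite divr_gt0.
Unshelve. all: by end_near. Qed.

(** * Global existence by Picard iteration *)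

Section Picard.
Context {R : realType} {I : finType}.
Variables (F : (I -> R) -> I -> R) (K : R) (z0 : I -> R).
Hypotheses (K0 : 0 < K) (FK : coord_lipschitz K F).
Implicit Types (X Y : R -> I -> R).

(* Curves only matter on [0, +oo[; composing with [Num.max 0] makes the
   integrands continuous on the whole line. *)
Let regular X := forall i, continuous (fun t : R => X (Num.max 0 t) i).

(** With continuity moved under the existential, [choice] yields an operator [A] on all functions;
    its value at a discontinuous [u] is arbitrary. *)
Let antider (u : R -> R) : exists U : R -> R, continuous u ->
  U 0 = 0 /\ forall t : R, 0 <= t -> is_derive t 1 U (u t).
Proof.
have [cu|ncu] := pselect (continuous u); last by exists u.
by have [U UP] := antiderivative R u cu; exists U.
Qed.

Let A := projT1 (choice antider).
Let AP : forall u, continuous u ->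
  A u 0 = 0 /\ forall t : R, 0 <= t -> is_derive t 1 (A u) (u t).
Proof. exact: projT2 (choice antider). Qed.

(** For regular [X] and [t >= 0] this is the integral operator [z0] plus the integral of [F (X s)]
    over [0, t]. *)
Let picard X t i := z0 i + A (fun s => F (X (Num.max 0 s)) i) t.

Let E t := expR (2 * K * t).

Let E_gt0 t : 0 < E t. Proof. exact: expR_gt0. Qed.

Let regular_F X : regular X ->
  forall i, continuous (fun t : R => F (X (Num.max 0 t)) i).
Proof.
move=> rX i t.
apply: (@continuous_coord_lipschitz _ _ K F (fun t : R => X (Num.max 0 t))) => // j.
exact: rX.
Qed.

Let picard0 X : regular X -> picard X 0 =1 z0.
Proof. by move=> rX i; rewrite /picard (AP _ (regular_F _ rX i)).1 addr0. Qed.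

Let is_derive_picard X i (t : R) : regular X -> 0 <= t ->
  is_derive t 1 (fun t => picard X t i) (F (X t) i).
Proof.
move=> rX t0; have [_ /(_ t t0)] := AP _ (regular_F _ rX i).
rewrite max_r// => DA.
have -> : (fun t => picard X t i) = cst (z0 i) + A (fun s => F (X (Num.max 0 s)) i).
  by [].
by apply: is_derive_eq; rewrite add0r.
Qed.

Let continuous_max0 (t : R) : {for t, continuous (fun s : R => Num.max 0 s)}.
Proof.
apply: (@continuous_max R R (cst 0) id); first exact: cvg_cst.
exact: cvg_id.
Qed.

Let regular_picard X : regular X -> regular (picard X).
Proof.
move=> rX i t.
apply: (@continuous_comp _ _ _ (fun s : R => Num.max 0 s) (fun s => picard X s i)).
  exact: continuous_max0.
apply/differentiable_continuous/derivable1_diffP.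
have [] // := is_derive_picard X i (Num.max 0 t) rX _.
by rewrite le_max lexx.
Qed.

Let picard_within X i T : regular X ->
  {within `[0, T], continuous (fun t => picard X t i)}.
Proof.
move=> rX; apply: derivable_within_continuous => t; rewrite in_itv/= => /andP[t0 _].
by have [] := is_derive_picard X i t rX t0.
Qed.

Let picard_contraction X Y (C : R) : regular X -> regular Y -> 0 <= C ->
  (forall (t : R) i, 0 <= t -> `|X t i - Y t i| <= C * E t) ->
  forall (t : R) i, 0 <= t -> `|picard X t i - picard Y t i| <= C / 2 * E t.
Proof.
move=> rX rY C0 XYC t i t0.
apply: (@halve_exp_bound R K C t (fun t => picard X t i - picard Y t i)
  (fun t => F (X t) i - F (Y t) i)) => //.
- by move=> u; apply: cvgB; exact: picard_within.
- by move=> u /andP[/ltW u0 _]; apply: is_deriveB; exact: is_derive_picard.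
- by move=> u /andP[/ltW u0 _]; apply: FK => j; exact: XYC.
- by rewrite !picard0// subrr.
Qed.

Let X_ k := iter k picard (fun _ => z0).

Let regular_iterate k : regular (X_ k).
Proof.
elim: k => [|k IH]; last exact: regular_picard.
by move=> i t; exact: cvg_cst.
Qed.

Let iterate_step : exists2 C : R, 0 <= C & forall k (t : R) i, 0 <= t ->
  `|X_ k.+1 t i - X_ k t i| <= C / 2 ^+ k * E t.
Proof.
have [M M0 FM] : exists2 M : R, 0 <= M & forall i, `|F z0 i| <= M.
  apply: (@common_bound R I (fun i M => `|F z0 i| <= M)).
    by move=> i a b ab /le_trans; apply.
  by move=> i; exists `|F z0 i|.
(* Since [E t >= 1] for [t >= 0], [M <= K * (M / K * E t)], so [halve_exp_bound] controls the first
   increment; later ones follow by contraction. *)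
exists (M / K); first by rewrite divr_ge0// ltW.
elim=> [|k IH] t i t0; last first.
  rewrite exprSr invfM mulrA; apply: picard_contraction => //.
    exact: (regular_iterate k.+1).
  by rewrite !divr_ge0 ?exprn_ge0// ltW.
apply: (@le_trans _ _ (M / K / 2 * E t)).
  apply: (@halve_exp_bound R K (M / K) t (fun t => picard (X_ 0) t i - z0 i)
    (fun t => F z0 i)) => //.
  - by move=> u; apply: cvgB; [exact: picard_within|exact: cvg_cst].
  - move=> u /andP[/ltW u0 _].
    have -> : (fun t => picard (X_ 0) t i - z0 i) =
        (fun t => picard (X_ 0) t i) - cst (z0 i) by [].
    have := is_derive_picard (X_ 0) i u (regular_iterate 0) u0.
    by move=> D; apply: is_derive_eq; rewrite subr0.
  - move=> u /andP[/ltW u0 _]; rewrite mulrA mulrCA divff ?lt0r_neq0// mulr1.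
    rewrite (le_trans (FM i))// ler_peMr//.
    by rewrite -expR0 ler_expR !mulr_ge0// ltW.
  - by rewrite picard0 ?subrr//; exact: (regular_iterate 0).
  - by rewrite divr_ge0// ltW.
rewrite ler_pM2r//  expr0 divr1 ler_piMr ?divr_ge0 ?(ltW K0)//.
by rewrite invf_le1 ?ler1n// ltr0n.
Qed.

(** The increments are dominated by a geometric series, so the iterates converge pointwise, and
    uniformly on bounded intervals of times [t >= 0]; hence the limit is regular. *)
Let iterate_limit : exists2 X, regular X & exists2 C : R, 0 <= C &
  forall k (t : R) i, 0 <= t -> `|X_ k t i - X t i| <= C / 2 ^+ k * E t.
Proof.
have [C C0 step] := iterate_step.
(* The right-hand side is the exact sum of the [m] step bounds from index [k] on, which lets the
   induction close; the factor [1 - 1 / 2 ^+ m] is then dropped. *)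
have dist k m (t : R) i : 0 <= t ->
    `|X_ (k + m)%N t i - X_ k t i| <= C * 2 / 2 ^+ k * (1 - 1 / 2 ^+ m) * E t.
  move=> t0; elim: m => [|m IH].
    by rewrite addn0 subrr normr0 expr0 divr1 subrr mulr0 mul0r.
  rewrite -(subrKA (X_ (k + m)%N t i)) (le_trans (ler_normD _ _))//.
  rewrite addnS (le_trans (lerD (step _ _ _ t0) IH))//.
  rewrite -mulrDl ler_pM2r// exprD exprS.
  have k0 : (2 : R) ^+ k != 0 by rewrite expf_neq0.
  have m0 : (2 : R) ^+ m != 0 by rewrite expf_neq0.
  by rewrite le_eqVlt; apply/orP; left; apply/eqP; field; rewrite k0 m0.
have {}dist k m (t : R) i : 0 <= t ->
    `|X_ (k + m)%N t i - X_ k t i| <= C * 2 / 2 ^+ k * E t.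
  move=> t0; apply: (le_trans (dist k m t i t0)).
  rewrite ler_pM2r//; apply: ler_piMr.
    by rewrite divr_ge0 ?mulr_ge0 ?exprn_ge0.
  by rewrite gerBl divr_ge0 ?exprn_ge0.
have half1 : `|2^-1 : R| < 1 by rewrite ger0_norm ?invr_ge0// invf_lt1// ltr1n.
have cvgX (t : R) i : 0 <= t -> cvgn (fun k => X_ k t i).
  move=> t0.
  have cvgS : cvgn (series (telescope (fun k => X_ k t i))).
    apply: normed_cvg.
    apply: (@series_le_cvg _ _ (geometric (C * E t) 2^-1)).
    - by move=> k; exact: normr_ge0.
    - by move=> k; rewrite /geometric/= mulr_ge0 ?mulr_ge0 ?exprn_ge0 ?invr_ge0// ltW.
    - by move=> k; rewrite /geometric/= exprVn mulrAC; exact: step.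
    - exact: is_cvg_geometric_series.
  have -> : (fun k => X_ k t i) =
      cst (X_ 0 t i) + series (telescope (fun k => X_ k t i)).
    by apply/funext => k; exact: (eq_sum_telescope (fun k => X_ k t i) k).
  by apply: is_cvgD => //; exact: is_cvg_cst.
pose X t i := limn (fun k => X_ k t i).
have XE k (t : R) i : 0 <= t -> `|X_ k t i - X t i| <= C * 2 / 2 ^+ k * E t.
  move=> t0.
  have XX : (fun k => X_ k t i) @ \oo --> X t i by exact: cvgX.
  (* Let [m] tend to infinity in [dist]. *)
  rewrite -(cvg_shiftn k) in XX.
  have : `|X_ k t i - X_ (k + m)%N t i| @[m --> \oo] --> `|X_ k t i - X t i|.
    apply: cvg_norm; apply: cvgB; first exact: cvg_cst.
    under eq_fun do rewrite addnC.
    exact: XX.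
  move=> /cvgr_to_le; apply; apply: nearW => m.
  by rewrite distrC; exact: dist.
exists X; last by exists (C * 2) => //; rewrite mulr_ge0.
move=> i t; apply/cvgrPdist_le => e e0.
(* As [E] is increasing, [B / 2 ^+ k] bounds the distance to the limit on all of [0,
   [Num.max 0 t + 1]]. A three-epsilon argument through the continuous [X_ k] concludes. *)
pose B := C * 2 * E (Num.max 0 t + 1).
have [k Bk] : exists k, B / 2 ^+ k <= e / 3.
  apply: contrapT => /forallNP nB.
  suff : e / 3 <= 0 by apply/negP; rewrite -ltNge divr_gt0.
  apply: (le0_of_le_halves _ _ B) => k.
  by rewrite leNgt; apply/negP => /ltW; exact: nB.
have near_t (s : R) : 0 <= s -> s <= Num.max 0 t + 1 -> `|X_ k s i - X s i| <= e / 3.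
  move=> s0 st; apply: le_trans (XE k s i s0) _; apply: le_trans _ Bk.
  rewrite /B [leRHS]mulrAC ler_wpM2l//.
    by rewrite !mulr_ge0// invr_ge0 exprn_ge0.
  by rewrite ler_expR ler_pM2l// mulr_gt0.
have max0 (s : R) : 0 <= Num.max 0 s by rewrite le_max lexx.
near=> u.
have ut : Num.max 0 u <= Num.max 0 t + 1.
  near: u.
  have := continuous_max0 t => /cvgrPdist_le /(_ 1 ltr01).
  by apply: filterS => u; rewrite ler_norml; lra.
have Xut : `|X_ k (Num.max 0 t) i - X_ k (Num.max 0 u) i| <= e / 3.
  near: u.
  have := regular_iterate k i t => /cvgrPdist_le; apply.
  by rewrite divr_gt0.
have := near_t (Num.max 0 t) (max0 t) _.
have := near_t (Num.max 0 u) (max0 u) ut.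
move: Xut; rewrite !ler_norml lerDl ler01 => Xut Xu /(_ isT) Xt; lra.
Unshelve. all: by end_near. Qed.

Lemma lipschitz_ode_exists : exists X : R -> I -> R, X 0 =1 z0 /\
  forall i (t : R), 0 <= t -> is_derive t 1 (fun t => X t i) (F (X t) i).
Proof.
have [X rX [C C0 XC]] := iterate_limit.
(* Both sides are within a multiple of [E t / 2 ^+ k] of the iterate [X_ k.+1]: one by contraction,
   the other by the choice of [X]. *)
have fixX (t : R) i : 0 <= t -> picard X t i = X t i.
  move=> t0; apply/eqP; rewrite -subr_eq0 -normr_le0.
  apply: (@le0_of_le_halves _ _ (C * E t)) => k.
  rewrite -(subrKA (X_ k.+1 t i)) (le_trans (ler_normD _ _))//.
  rewrite mulrAC.
  apply: (@le_trans _ _ (C / 2 ^+ k / 2 * E t + C / 2 ^+ k.+1 * E t)); last first.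
    rewrite exprS -mulrDl ler_pM2r// le_eqVlt; apply/orP; left; apply/eqP.
    by field; rewrite expf_neq0.
  apply: lerD; last exact: XC.
  rewrite distrC; apply: picard_contraction => //.
    by rewrite divr_ge0// exprn_ge0.
  by move=> u j u0; exact: XC.
(* The witness is [picard X] because the derivative at 0 is two-sided and [X] is not controlled at
   negative times. *)
exists (picard X); split; first exact: picard0.
move=> i t t0; have -> : picard X t = X t by apply/funext => j; exact: fixX.
exact: is_derive_picard.
Qed.

End Picard.

(** * Curves in row vectors *)

Lemma is_derive_rV (R : realType) (n : nat) (X : R -> 'rV[R]_n)
    (v : 'rV[R]_n) (t : R) :
  is_derive t 1 X v <->
  forall i, is_derive t 1 (fun s => X s ord0 i) (v ord0 i).
Proof.
split=> [[dX <-] i|dX].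
  split; first exact: (derivable_mxP X t 1).1.
  by rewrite (derive_mx dX) mxE.
have dX' : derivable X t 1.
  by apply/derivable_mxP => i j; rewrite (ord1 i); have [] := dX j.
split=> //; rewrite (derive_mx dX'); apply/rowP => j; rewrite mxE.
by have [] := dX j.
Qed.

Lemma cvg_rV (R : realType) (n : nat) (T : Type) (G : set_system T) (FG : Filter G)
    (g : T -> 'rV[R]_n) (l : 'rV[R]_n) :
  (forall i, g x ord0 i @[x --> G] --> l ord0 i) -> g x @[x --> G] --> l.
Proof.
move=> gl; apply/cvgrPdist_le => e e0; near=> x.
rewrite /Num.Def.normr/= mx_normrE (bigmax_le _ (ltW e0))//= => -[i j] _.
rewrite !mxE/= (ord1 i); move: j; near: x; apply: filter_forall => j.
exact: ((cvgrPdist_le _ _).1 (gl j)).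
Unshelve. all: by end_near. Qed.

Lemma difference_quotientE (R : realType) (n : nat) (X : R -> 'rV[R]_n) (t : R) :
  (fun h => h^-1 *: (X (h *: 1 + t) - X t)) = (fun h => h^-1 *: (X (t + h) - X t)).
Proof. by apply/funext => h; rewrite [h *: 1]mulr1 (addrC h). Qed.

Lemma is_derive_deriv_nonneg (R : realType) (n : nat) (X V : R -> 'rV[R]_n) :
  (forall t : R, 0 <= t -> is_derive t 1 X (V t)) -> deriv_nonneg X V.
Proof.
move=> DX t t0; apply: cvg_within_filter.
have [dX <-] := DX t t0.
by have := dX; rewrite /derivable /derive difference_quotientE.
Qed.

(** At an interior time the constraint [0 <= t + h] holds once [|h| < t], so the restricted filter
    is the full punctured neighbourhood. *)
Lemma deriv_nonneg_is_derive (R : realType) (n : nat) (X V : R -> 'rV[R]_n) (t : R) :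
  deriv_nonneg X V -> 0 < t -> is_derive t 1 X (V t).
Proof.
move=> DX t0.
have DX' : h^-1 *: (X (h *: 1 + t) - X t) @[h --> 0^'] --> V t.
  rewrite difference_quotientE.
  apply: cvg_trans (DX t (ltW t0)) => A; rewrite /nbhs/= /within/= => XA.
  have : \forall h \near (0:R)^', 0 <= t + h.
    near=> h; have : `|h| < t by near: h; exact: dnbhs0_lt.
    by rewrite ltr_norml; lra.
  by apply: filterS2 XA => h /[apply].
split; first by apply/cvg_ex; exists (V t).
exact: cvg_lim DX'.
Unshelve. all: by end_near. Qed.

(** Near [t] the difference quotients are within 1 of [V t], so the increment of [X] is at most [M]
    times [|s - t|]. This covers the endpoint 0. *)
Lemma deriv_nonneg_continuous (R : realType) (n : nat) (X V : R -> 'rV[R]_n) :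
  deriv_nonneg X V -> {within [set t : R | 0 <= t], continuous X}.
Proof.
move=> DX; apply/subspace_continuousP => t /= t0.
apply/cvgrPdist_le => e e0.
have /cvgrPdist_le /(_ 1 ltr01) := DX t t0.
set M := `|V t| + 1.
have M0 : 0 < M by rewrite ltr_wpDl.
move=> /nbhs_ballP[d /= d0 dP].
near=> s.
have [->|st] := eqVneq s t; first by rewrite subrr normr0 ltW.
have s0 : 0 <= s by near: s; exact: withinT.
have q1 : `|V t - (s - t)^-1 *: (X s - X t)| <= 1.
  have := dP (s - t); rewrite /= !subrKC; apply => //; last by rewrite subr_eq0.
  rewrite -ball_normE/= sub0r normrN distrC.
  by near: s; apply: cvg_within; exact: (cvgr_dist_lt id t (@cvg_id _ (nbhs t))).
rewrite distrC.
have -> : X s - X t = (s - t) *: ((s - t)^-1 *: (X s - X t)).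
  by rewrite scalerA divff ?scale1r// subr_eq0.
rewrite normrZ -[e](divfK (lt0r_neq0 M0)) ler_pM//.
  rewrite distrC; near: s; apply: cvg_within.
  apply: (cvgr_dist_le id t (@cvg_id _ (nbhs t))).
  exact: divr_gt0.
have := ler_normB (V t) (V t - (s - t)^-1 *: (X s - X t)).
rewrite subKr => /le_trans; apply.
by rewrite /M lerD2l.
Unshelve. all: by end_near. Qed.

(** * Gradient and Hessian along a curve *)

Lemma enorm_le (R : realType) (n : nat) (v : 'rV[R]_n) (e : R) :
  0 <= e -> (forall i, `|v ord0 i| <= e) -> enorm v <= n%:R * e.
Proof.
move=> e0 ve; have ne0 : 0 <= n%:R * e by rewrite mulr_ge0.
rewrite -(ger0_norm ne0) -sqrtr_sqr ler_wsqrtr//.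
apply: (@le_trans _ _ (\sum_(i < n) e ^+ 2)).
  apply: ler_sum => i _; rewrite -expr2 -real_normK ?num_real//.
  by rewrite ler_pXn2r// nnegrE.
rewrite sumr_const card_ord -[leLHS]mulr_natl exprMn ler_wpM2r ?sqr_ge0//.
(* The crude bound [n <= n ^ 2] gives the factor [n] in place of its square root. *)
by rewrite -natrX ler_nat; case: (n) => // m; rewrite leq_pmulr.
Qed.

Lemma coord_le_enorm (R : realType) (n : nat) (v : 'rV[R]_n) (i : 'I_n) :
  `|v ord0 i| <= enorm v.
Proof.
rewrite -sqrtr_sqr ler_wsqrtr// /dotp (bigD1 i)//= -expr2 lerDl.
by apply: sumr_ge0 => j _; rewrite -expr2 sqr_ge0.
Qed.

Lemma entry_le_frob (R : realType) (n : nat) (M : 'M[R]_n) (i j : 'I_n) :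
  `|M i j| <= frob M.
Proof.
rewrite -sqrtr_sqr ler_wsqrtr// (bigD1 i)//= (bigD1 j)//= -addrA lerDl.
by rewrite addr_ge0// ?sumr_ge0// => k _; rewrite ?sumr_ge0// => *; rewrite sqr_ge0.
Qed.

Lemma coord_le_norm (R : realType) (n : nat) (v : 'rV[R]_n) (i : 'I_n) :
  `|v ord0 i| <= `|v|.
Proof.
rewrite [leRHS]/Num.Def.normr/= mx_normrE.
exact: (le_bigmax _ (fun ij => `|v ij.1 ij.2|) (ord0, i)).
Qed.

Lemma grad_coord_lipschitz (R : realType) (n : nat) (L : R) (f : 'rV[R]_n -> R)
    (x y : 'rV[R]_n) (e : R) :
  0 <= L -> F1 L f -> (forall i, `|x ord0 i - y ord0 i| <= e) ->
  forall i, `|grad f x ord0 i - grad f y ord0 i| <= L * n%:R * e.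
Proof.
move=> L0 [_ [_ gL]] xye i.
have e0 : 0 <= e := le_trans (normr_ge0 _) (xye i).
have := coord_le_enorm R n (grad f x - grad f y) i; rewrite !mxE => /le_trans; apply.
rewrite (le_trans (gL x y))// -mulrA ler_wpM2l// enorm_le// => j.
by rewrite !mxE.
Qed.

Lemma continuous_hess (R : realType) (n : nat) (L' : R) (f : 'rV[R]_n -> R)
    (i j : 'I_n) :
  0 < L' -> (forall x y, frob (hess f x - hess f y) <= L' * enorm (x - y)) ->
  continuous (fun x => hess f x i j).
Proof.
move=> L0 fL x; apply: (cvgrPdist_le (F := nbhs x) _ _).2 => e e0.
have n0 : 0 < n%:R :> R by rewrite ltr0n (leq_trans _ (ltn_ord i)).
have d0 : 0 < e / (L' * n%:R) by rewrite divr_gt0// mulr_gt0.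
have xnear : nbhs x (fun y => `|x - y| <= e / (L' * n%:R)).
  exact: (@cvgr_dist_le R 'rV[R]_n 'rV[R]_n (nbhs x) _ id x cvg_id _ d0).
apply: (filterS _ xnear) => y; rewrite ler_pdivlMr ?mulr_gt0// => xy.
have := entry_le_frob R n (hess f x - hess f y) i j.
have -> : (hess f x - hess f y) i j = hess f x i j - hess f y i j.
  by rewrite [LHS]mxE; congr (_ + _); rewrite [LHS]mxE.
move=> /le_trans; apply.
apply: (le_trans (fL x y)); apply: le_trans xy.
rewrite [leRHS]mulrC -[leRHS]mulrA ler_pM2l// enorm_le// => k.
exact: coord_le_norm.
Qed.

(** The differential is linear: expand [v] over the basis vectors, where it takes the columns of the
    Hessian as values. *)
Lemma derive_grad (R : realType) (n : nat) (f : 'rV[R]_n -> R) (x v : 'rV[R]_n) :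
  differentiable (grad f) x -> 'D_v (grad f) x = hessmul f x v.
Proof.
move=> dg; rewrite deriveE// {1}(row_sum_delta v) linear_sum.
apply/rowP => i; rewrite summxE !mxE; apply: eq_bigr => j _.
rewrite linearZ/= mxE mulrC; congr (_ * _).
by rewrite -deriveE// derive_mx ?mxE//; exact: diff_derivable.
Qed.

Lemma is_derive_grad_comp (R : realType) (n : nat) (f : 'rV[R]_n -> R)
    (X : R -> 'rV[R]_n) (v : 'rV[R]_n) (t : R) :
  differentiable (grad f) (X t) -> is_derive t 1 X v ->
  is_derive t 1 (fun s => grad f (X s)) (hessmul f (X t) v).
Proof.
move=> dg [/derivable1_diffP dX <-].
have dgX : differentiable (grad f \o X) t by exact: differentiable_comp.
split; first exact/derivable1_diffP.
rewrite -(derive_grad _ _ _ _ _ dg) (deriveE _ dg) (deriveE _ dX).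
apply: (etrans (deriveE (f := grad f \o X) 1 dgX)).
by have /(congr1 (fun h => h 1)) := diff_comp dX dg.
Qed.

(** * The second-order equation *)

Section HessianDampedOde.
Context {R : realType} {n : nat}.
Variables (f : 'rV[R]_n -> R) (a b c L L' : R).
Hypotheses (a0 : 0 <= a) (b0 : 0 <= b) (c0 : 0 <= c) (L0 : 0 <= L) (L'0 : 0 < L').
Hypothesis fF1 : F1 L f.
Hypothesis dgrad : forall x, differentiable (grad f) x.
Hypothesis hess_lip : forall x y, frob (hess f x - hess f y) <= L' * enorm (x - y).
Variables x0 v0 : 'rV[R]_n.

Let solution (X : R -> 'rV[R]_n) :=
  exists X1 X2 : R -> 'rV[R]_n,
    C2_nonneg X X1 X2 /\ X 0 = x0 /\ X1 0 = v0 /\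
    forall t : R, 0 <= t ->
      X2 t + a *: X1 t + b *: hessmul f (X t) (X1 t) + c *: grad f (X t) = 0.

Let position (z : 'I_n + 'I_n -> R) : 'rV[R]_n := \row_j z (inl j).

(** The left summand of the index type carries X and the right one V; [state] below is the change of
    variables from (X, X') to (X, V). *)
Let field (z : 'I_n + 'I_n -> R) (k : 'I_n + 'I_n) : R :=
  match k with
  | inl i => z (inr i) - a * z (inl i) - b * grad f (position z) ord0 i
  | inr i => - (c * grad f (position z) ord0 i)
  end.

Let state (x v : 'rV[R]_n) (k : 'I_n + 'I_n) : R :=
  match k with
  | inl i => x ord0 i
  | inr i => v ord0 i + a * x ord0 i + b * grad f x ord0 i
  end.

Let position_state x v : position (state x v) = x.
Proof. by apply/rowP => i; rewrite mxE. Qed.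

(** The sum of the constants of the two blocks: [1 + a + b * (L * n%:R)] for X and [c * (L * n%:R)]
    for V. *)
Let K := 1 + a + (b + c) * (L * n%:R).

Let K_gt0 : 0 < K.
Proof. by rewrite ltr_wpDr ?ltr_wpDr// mulr_ge0 ?addr_ge0 ?mulr_ge0. Qed.

Let field_lipschitz : coord_lipschitz K field.
Proof.
move=> y z e yze k.
have e0 : 0 <= e := le_trans (normr_ge0 _) (yze k).
have gyz i : `|grad f (position y) ord0 i - grad f (position z) ord0 i|
    <= L * n%:R * e.
  by apply: grad_coord_lipschitz => // j; rewrite !mxE.
have Ge0 : 0 <= L * n%:R * e by rewrite !mulr_ge0.
have KE : K * e = e + a * e + b * (L * n%:R * e) + c * (L * n%:R * e).
  by rewrite /K; ring.
have ae0 : 0 <= a * e by rewrite mulr_ge0.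
have bG0 := mulr_ge0 b0 Ge0; have cG0 := mulr_ge0 c0 Ge0.
rewrite KE; case: k => i /=.
  set gy := grad f _ _ _; set gz := grad f _ _ _.
  have ag : `|a * (y (inl i) - z (inl i))| <= a * e.
    by rewrite normrM ger0_norm// ler_wpM2l.
  have bg : `|b * (gy - gz)| <= b * (L * n%:R * e).
    by rewrite normrM ger0_norm// ler_wpM2l// gyz.
  have := yze (inr i); move: ag bg; rewrite !ler_norml !mulrBr; lra.
set gy := grad f _ _ _; set gz := grad f _ _ _.
have cg : `|c * (gy - gz)| <= c * (L * n%:R * e).
  by rewrite normrM ger0_norm// ler_wpM2l// gyz.
move: cg; rewrite !ler_norml !mulrBr; lra.
Qed.

(** On the left block the added terms cancel. On the right one the chain rule produces the Hessian
    term, and the equation turns the sum into [- (c *: grad f (X t))]. *)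
Let solution_state (X X1 X2 : R -> 'rV[R]_n) (t : R) :
  is_derive t 1 X (X1 t) -> is_derive t 1 X1 (X2 t) ->
  X2 t + a *: X1 t + b *: hessmul f (X t) (X1 t) + c *: grad f (X t) = 0 ->
  forall k, is_derive t 1 (fun s => state (X s) (X1 s) k)
    (field (state (X t) (X1 t)) k).
Proof.
move=> DX DX1 ode [] i /=; rewrite position_state.
  have -> : X1 t ord0 i + a * X t ord0 i + b * grad f (X t) ord0 i -
    a * X t ord0 i - b * grad f (X t) ord0 i = X1 t ord0 i by ring.
  exact: (is_derive_rV _ _ _ _ _).1 DX i.
have Dg := is_derive_grad_comp _ _ _ _ _ _ (dgrad (X t)) DX.
pose W s := X1 s + a *: X s + b *: grad f (X s).
have -> : (fun s => X1 s ord0 i + a * X s ord0 i + b * grad f (X s) ord0 i) =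
    (fun s => W s ord0 i).
  by apply/funext => s; rewrite !mxE.
have DW : is_derive t 1 W (X2 t + a *: X1 t + b *: hessmul f (X t) (X1 t)).
  have -> : W = X1 + (a \*: X) + (b \*: (fun s => grad f (X s))) by [].
  by apply: is_deriveD.
move: ode => /eqP; rewrite addr_eq0 => /eqP ode; rewrite ode in DW.
by have := (is_derive_rV _ _ _ _ _).1 DW i; rewrite !mxE.
Qed.

Let state_within_continuous (X X1 X2 : R -> 'rV[R]_n) (T : R) k :
  C2_nonneg X X1 X2 ->
  {within `[0, T], continuous (fun s => state (X s) (X1 s) k)}.
Proof.
move=> [DX [DX1 _]].
have /subspace_continuousP cX := deriv_nonneg_continuous _ _ _ _ DX.
have /subspace_continuousP cX1 := deriv_nonneg_continuous _ _ _ _ DX1.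
have sub : `[0, T] `<=` [set t : R | 0 <= t].
  by move=> t /=; rewrite in_itv/= => /andP[].
apply: (continuous_subspaceW sub); apply/subspace_continuousP => t t0.
have coordc (Y : R -> 'rV[R]_n) i :
    Y s @[s --> within [set t : R | 0 <= t] (nbhs t)] --> Y t ->
    Y s ord0 i @[s --> within [set t : R | 0 <= t] (nbhs t)] --> Y t ord0 i.
  move=> cY; apply: (cvg_comp Y (fun v : 'rV[R]_n => v ord0 i) cY).
  exact: coord_continuous.
case: k => i /=; first exact/coordc/cX.
apply: cvgD; first apply: cvgD; first exact/coordc/cX1.
  by apply: cvgM; [exact: cvg_cst|exact/coordc/cX].
apply: cvgM; first exact: cvg_cst.
apply: (coordc (fun s => grad f (X s))).
apply: (cvg_comp X (grad f) (cX t t0)).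
exact/differentiable_continuous/dgrad.
Qed.

(** Equal initial data give equal initial states, so the two trajectories of [field] coincide; the
    left components are the positions. *)
Lemma hessian_damped_unique (X Y : R -> 'rV[R]_n) (t : R) :
  solution X -> solution Y -> 0 <= t -> Y t = X t.
Proof.
move=> [X1 [X2 [CX [X0 [X10 odeX]]]]] [Y1 [Y2 [CY [Y0 [Y10 odeY]]]]] t0.
apply/rowP => i.
apply: (lipschitz_ode_unique _ _ _ _ t (fun s => state (Y s) (Y1 s))
  (fun s => state (X s) (X1 s)) K_gt0 field_lipschitz t0 _ _ _ _ _ (inl i)).
- by move=> k; exact: state_within_continuous CY.
- by move=> k; exact: state_within_continuous CX.
- move=> k s /andP[s0 _]; case: CY => DY [DY1 _].
  apply: (solution_state _ _ Y2); [exact: deriv_nonneg_is_derive..|].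
  exact: odeY (ltW s0).
- move=> k s /andP[s0 _]; case: CX => DX [DX1 _].
  apply: (solution_state _ _ X2); [exact: deriv_nonneg_is_derive..|].
  exact: odeX (ltW s0).
- by move=> k; rewrite X0 X10 Y0 Y10.
Qed.

Lemma hessian_damped_exists : exists X, solution X.
Proof.
have [Z [Z0 DZ]] :=
  lipschitz_ode_exists field K (state x0 v0) K_gt0 field_lipschitz.
pose X t := position (Z t).
pose X1 t : 'rV[R]_n := \row_i field (Z t) (inl i).
(* Solving the equation for the acceleration makes it hold by construction; what remains is that
   [X2] is the derivative of [X1] and is continuous. *)
pose X2 t := - (a *: X1 t + b *: hessmul f (X t) (X1 t) + c *: grad f (X t)).
have DX (t : R) : 0 <= t -> is_derive t 1 X (X1 t).
  move=> t0; apply/is_derive_rV => i; rewrite mxE.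
  have -> : (fun s => X s ord0 i) = (fun s => Z s (inl i)).
    by apply/funext => s; rewrite mxE.
  exact: DZ.
have DX1 (t : R) : 0 <= t -> is_derive t 1 X1 (X2 t).
  move=> t0.
  have Dg := is_derive_grad_comp _ _ _ _ _ _ (dgrad (X t)) (DX t t0).
  pose W t : 'rV[R]_n := \row_i Z t (inr i).
  have DW : is_derive t 1 W (- (c *: grad f (X t))).
    apply/is_derive_rV => i; rewrite !mxE.
    have -> : (fun s => W s ord0 i) = (fun s => Z s (inr i)).
      by apply/funext => s; rewrite mxE.
    by have := DZ (inr i) t t0; rewrite /= mxE.
  (* Every term on the right is differentiable, which gives the second derivative of [X]. *)
  have -> : X1 = W - (a \*: X) - (b \*: (fun s => grad f (X s))).
    by apply/funext => s; apply/rowP => i; rewrite !mxE /= mxE.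
  have DXt := DX t t0.
  by apply: is_derive_eq; rewrite /X2 !opprD [RHS]addrC addrA.
have cX (t : R) : 0 <= t -> {for t, continuous X}.
  by move=> /DX [/derivable1_diffP/differentiable_continuous].
have cX1 (t : R) : 0 <= t -> {for t, continuous X1}.
  by move=> /DX1 [/derivable1_diffP/differentiable_continuous].
have coordc (Y : R -> 'rV[R]_n) (t : R) i : {for t, continuous Y} ->
    {for t, continuous (fun s => Y s ord0 i)}.
  move=> cY; apply: (cvg_comp Y (fun v : 'rV[R]_n => v ord0 i) cY).
  exact: coord_continuous.
exists X, X1, X2; split; [split; [|split]|split; [|split]].
- exact: is_derive_deriv_nonneg.
- exact: is_derive_deriv_nonneg.
- apply: continuous_in_subspaceT => t; rewrite inE/= => t0.
  apply: cvgN; apply: cvgD; first apply: cvgD.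
  + by apply: cvgZl_tmp; exact: cX1.
  + apply: cvgZl_tmp; apply: cvg_rV => i; rewrite mxE.
    under eq_fun do rewrite mxE.
    apply: cvg_big => [|j _]; first exact: add_continuous.
    apply: cvgM; last exact/coordc/cX1.
    apply: (cvg_comp X (fun x => hess f x i j) (cX t t0)).
    exact: continuous_hess L'0 hess_lip _.
  + apply: cvgZl_tmp; apply: (cvg_comp X (grad f) (cX t t0)).
    exact/differentiable_continuous/dgrad.
- by apply/rowP => i; rewrite !mxE Z0.
- apply/rowP => i; rewrite mxE /= !Z0 /=.
  have -> : position (Z 0) = x0.
    by apply/rowP => j; rewrite !mxE Z0.
  ring.
- by move=> t t0; rewrite /X2 -!addrA addNr.
Qed.

End HessianDampedOde.

(** * Specialization to the coefficients of the high-resolution ODE *)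

Theorem theorem3p2 (R : realType) (n : nat) (mu s beta : R)
    (f : 'rV[R]_n -> R) (x0 : 'rV[R]_n) :
  0 < mu -> 0 < s -> 0 <= beta <= 1 -> S2mu mu f ->
  exists X : R -> 'rV[R]_n,
    HR_solution mu s beta f x0 X /\
    forall Y : R -> 'rV[R]_n, HR_solution mu s beta f x0 Y ->
      forall t : R, 0 <= t -> Y t = X t.
Proof.
move=> mu0 s0 /andP[beta0 _] [L [_ [[fF1 [dgrad [L' [L'0 hess_lip]]]] []]]].
move=> _ /andP[_ muL].
have L0 : 0 <= L := le_trans (ltW mu0) muL.
have a0 : 0 <= 2 * Num.sqrt mu by rewrite mulr_ge0 ?sqrtr_ge0.
have b0 : 0 <= beta * Num.sqrt s by rewrite mulr_ge0 ?sqrtr_ge0.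
have c0 : 0 <= 1 + Num.sqrt (mu * s) by rewrite addr_ge0 ?sqrtr_ge0.
have [X solX] := hessian_damped_exists f _ _ _ L L' a0 b0 c0 L0 L'0 fF1 dgrad
  hess_lip x0 (- ((2 * Num.sqrt s) / (1 + Num.sqrt (mu * s))) *: grad f x0).
(* [HR_solution] unfolds to the notion of solution used above with these coefficients and initial
   velocity. *)
exists X; split; first exact: solX.
move=> Y solY t t0.
exact: (hessian_damped_unique f _ _ _ L a0 b0 c0 L0 fF1 dgrad x0 _ X Y t
  solX solY t0).
Qed.
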